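(* Let $(\mathcal{M},\mathcal{W})$ be a partial model category. Then $\mathcal{W}$ is fibrant in the Thomason model structure on the category of small categories; that is, $\operatorname{Ex}^2 N\mathcal{W}$ is a Kan complex.
   Context: A relative category is a category $\mathcal{M}$ together with a subcategory $\mathcal{W}$ containing every object; the morphisms of $\mathcal{W}$ are called weak equivalences. A relative category $(\mathcal{M},\mathcal{W})$ is a partial model category if there are subclasses $\mathcal{C},\mathcal{F}\subset\mathcal{W}$ of morphisms (called (acyclic) cofibrations and (acyclic) fibrations, respectively) such that: (1) $\mathcal{W}$ satisfies the 2 out of 6 property: if $r,s,t$ are morphisms such that the compositions $sr$ and $ts$ exist and are in $\mathcal{W}$, then $r,s,t$ and $tsr$ are also in $\mathcal{W}$. (2) For every $f\in\mathcal{C}$, its pushouts along arbitrary maps in $\mathcal{M}$ exist and are again in $\mathcal{C}$. (3) For every $f\in\mathcal{F}$, its pullbacks along arbitrary maps in $\mathcal{M}$ exist and are again in $\mathcal{F}$. (4) Every weak equivalence can be functorially factorized into a cofibration followed by a fibration: there is a functor $F=(F_c,F_f)\colon \operatorname{Fun}(0\to1,\mathcal{W})\to\operatorname{Fun}(0\to1,\mathcal{C})\times\operatorname{Fun}(0\to1,\mathcal{F})$ such that for every morphism $g$ in $\mathcal{W}$, the morphisms $F_c(g),F_f(g)$ are composable and $F_f(g)\circ F_c(g)=g$. Here $\operatorname{Fun}(0\to1,\mathcal{C})$ and $\operatorname{Fun}(0\to1,\mathcal{F})$ are understood as the full subcategories of the arrow category $\operatorname{Fun}(0\to1,\mathcal{W})$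 on the arrows lying in $\mathcal{C}$, respectively $\mathcal{F}$. $N$ is the nerve functor from small categories to simplicial sets, with left adjoint $c$. $\operatorname{Sd}$ is Kan's barycentric subdivision functor on simplicial sets ($\operatorname{Sd}\Delta[n]$ is the nerve of the poset of non-degenerate simplices of $\Delta[n]$ ordered by the face relation, extended to all simplicial sets by colimits), and $\operatorname{Ex}$ is its right adjoint. In the Thomason model structure, a functor $f$ is a weak equivalence iff $Nf$ is a weak equivalence of simplicial sets, and a fibration iff $\operatorname{Ex}^2Nf$ is a Kan fibration. Thus a category $\mathcal{D}$ is fibrant iff $\operatorname{Ex}^2N\mathcal{D}$ is a Kan complex, equivalently iff $\mathcal{D}$ has the right lifting property with respect to all inclusions $c\operatorname{Sd}^2\Lambda^i[n]\to c\operatorname{Sd}^2\Delta[n]$ (the latter formulation is taken as the meaning of fibrancy if categories that are not small are allowed). *)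

(* Defs.v *)
(* Built on MathComp's finite ordinals and finite sets.  Functional
   extensionality and proof irrelevance give the presheaf laws below, which are
   stated with Leibniz equality of functors and of simplicial maps. *)
From mathcomp Require Import all_boot.
From Stdlib Require Import FunctionalExtensionality ProofIrrelevance.

Set Implicit Arguments.
Unset Strict Implicit.
Unset Printing Implicit Defensive.

Record Category := MkCategory {
  Ob :> Type;
  Hom : Ob -> Ob -> Type;
  idm : forall A, Hom A A;
  cmp : forall A B C, Hom B C -> Hom A B -> Hom A C;
  cmp_idl : forall A B (f : Hom A B), cmp (idm B) f = f;
  cmp_idr : forall A B (f : Hom A B), cmp f (idm A) = f;
  cmp_assoc : forall A B C D (h : Hom C D) (g : Hom B C) (f : Hom A B),
    cmp h (cmp g f) = cmp (cmp h g) f }.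

Arguments Hom {_} _ _.
Arguments idm {_} _.
Arguments cmp {_ _ _ _} _ _.

Notation "g \c f" := (cmp g f) (at level 40, left associativity).

Record Functor (C D : Category) := MkFunctor {
  fob :> C -> D;
  fmap : forall A B : C, Hom A B -> Hom (fob A) (fob B);
  fmap_id : forall A : C, fmap (idm A) = idm (fob A);
  fmap_cmp : forall (A B E : C) (g : Hom B E) (f : Hom A B),
    fmap (g \c f) = fmap g \c fmap f }.

Arguments fmap {_ _} _ {_ _} _.

Lemma Functor_eq (C D : Category) (o : C -> D)
    (m m' : forall A B : C, Hom A B -> Hom (o A) (o B)) i i' c c' :
  m = m' -> @MkFunctor C D o m i c = @MkFunctor C D o m' i' c'.
Proof. by move=> e; subst m'; f_equal; exact: proof_irrelevance. Qed.

Definition compF (C D E : Category) (G : Functor D E) (F : Functor C D) :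
  Functor C E.
Proof.
refine (@MkFunctor C E (fun x => G (F x)) (fun A B f => fmap G (fmap F f)) _ _).
- by move=> A; rewrite !fmap_id.
- by move=> A B D' g f; rewrite !fmap_cmp.
Defined.

Definition prodC (C D : Category) : Category.
Proof.
refine (@MkCategory (C * D)%type
  (fun x y => (Hom x.1 y.1 * Hom x.2 y.2)%type)
  (fun x => (idm x.1, idm x.2))
  (fun x y z g f => (g.1 \c f.1, g.2 \c f.2)) _ _ _).
- by move=> x y [f g]; rewrite /= !cmp_idl.
- by move=> x y [f g]; rewrite /= !cmp_idr.
- by move=> x y z t h g f; rewrite /= !cmp_assoc.
Defined.

Definition fullsub (C : Category) (P : C -> Prop) : Category :=
  @MkCategory {x : C | P x}
    (fun x y => Hom (proj1_sig x) (proj1_sig y))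
    (fun x => idm (proj1_sig x))
    (fun x y z g f => g \c f)
    (fun x y f => cmp_idl f)
    (fun x y f => cmp_idr f)
    (fun x y z t h g f => cmp_assoc h g f).

(* Objects and morphisms of Fun(0 -> 1, C). *)

Record Arrow (C : Category) := MkArrow {
  src : C;
  tgt : C;
  arr : Hom src tgt }.

Arguments MkArrow {_ _ _} _.

Record Square (C : Category) (g h : Arrow C) := MkSquare {
  sq_src : Hom (src g) (src h);
  sq_tgt : Hom (tgt g) (tgt h);
  sq_comm : sq_tgt \c arr g = arr h \c sq_src }.

Lemma Square_eq (C : Category) (g h : Arrow C) (s t : Square g h) :
  sq_src s = sq_src t -> sq_tgt s = sq_tgt t -> s = t.
Proof.
case: s t => [a b e] [a' b' e'] /= ea eb; subst a' b'.
by f_equal; exact: proof_irrelevance.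
Qed.

Definition Square_id (C : Category) (g : Arrow C) : Square g g.
Proof.
by refine (@MkSquare C g g (idm _) (idm _) _); rewrite cmp_idl cmp_idr.
Defined.

Definition Square_cmp (C : Category) (g h k : Arrow C)
  (t : Square h k) (s : Square g h) : Square g k.
Proof.
refine (@MkSquare C g k (sq_src t \c sq_src s) (sq_tgt t \c sq_tgt s) _).
by rewrite -cmp_assoc sq_comm !cmp_assoc sq_comm.
Defined.

Definition arrowC (C : Category) : Category.
Proof.
refine (@MkCategory (Arrow C) (@Square C) (@Square_id C) (@Square_cmp C) _ _ _).
- by move=> g h s; apply: Square_eq; rewrite /= cmp_idl.
- by move=> g h s; apply: Square_eq; rewrite /= cmp_idr.
- by move=> a b c d u t s; apply: Square_eq; rewrite /= cmp_assoc.
Defined.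

(*    A --a--> X
      |f       |f'
      B --b--> P   *)
Definition is_pushout (C : Category) (A B X P : C)
    (f : Hom A B) (a : Hom A X) (b : Hom B P) (f' : Hom X P) : Prop :=
  b \c f = f' \c a /\
  forall (Q : C) (h : Hom B Q) (k : Hom X Q), h \c f = k \c a ->
    exists! u : Hom P Q, u \c b = h /\ u \c f' = k.

(*    P --b--> A
      |f'      |f
      X --a--> B   *)
Definition is_pullback (C : Category) (A B X P : C)
    (f : Hom A B) (a : Hom X B) (b : Hom P A) (f' : Hom P X) : Prop :=
  f \c b = a \c f' /\
  forall (Q : C) (h : Hom Q A) (k : Hom Q X), f \c h = a \c k ->
    exists! u : Hom Q P, b \c u = h /\ f' \c u = k.

Record RelativeCategory := MkRelativeCategory {
  underlying :> Category;
  weq : forall A B : underlying, Hom A B -> Prop;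
  weq_id : forall A : underlying, weq (idm A);
  weq_cmp : forall (A B C : underlying) (g : Hom B C) (f : Hom A B),
    weq g -> weq f -> weq (g \c f) }.

Arguments weq {_ _ _} _.

Definition weqC (M : RelativeCategory) : Category.
Proof.
refine (@MkCategory M (fun A B => {f : Hom A B | weq f})
  (fun A => exist _ (idm A) (weq_id A))
  (fun A B C g f => exist _ (proj1_sig g \c proj1_sig f)
                      (weq_cmp (proj2_sig g) (proj2_sig f))) _ _ _).
- by move=> A B [f wf]; apply: eq_sig_hprop => /= [*|];
    [exact: proof_irrelevance | exact: cmp_idl].
- by move=> A B [f wf]; apply: eq_sig_hprop => /= [*|];
    [exact: proof_irrelevance | exact: cmp_idr].
- by move=> A B C D [h wh] [g wg] [f wf]; apply: eq_sig_hprop => /= [*|];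
    [exact: proof_irrelevance | exact: cmp_assoc].
Defined.

Definition two_out_of_six (M : RelativeCategory) : Prop :=
  forall (A B C D : M) (r : Hom A B) (s : Hom B C) (t : Hom C D),
    weq (s \c r) -> weq (t \c s) ->
    [/\ weq r, weq s, weq t & weq (t \c s \c r)].

Definition MorClass (C : Category) := forall A B : C, Hom A B -> Prop.

(* "Its pushouts exist and are again in K": some pushout exists, and every
   choice of a pushout lies in K; similarly for pullbacks. *)
Definition cobase_change_closed (C : Category) (K : MorClass C) : Prop :=
  forall (A B X : C) (f : Hom A B) (a : Hom A X), K A B f ->
    (exists (P : C) (b : Hom B P) (f' : Hom X P), is_pushout f a b f') /\
    (forall (P : C) (b : Hom B P) (f' : Hom X P),
       is_pushout f a b f' -> K X P f').

Definition base_change_closed (C : Category) (K : MorClass C) : Prop :=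
  forall (A B X : C) (f : Hom A B) (a : Hom X B), K A B f ->
    (exists (P : C) (b : Hom P A) (f' : Hom P X), is_pullback f a b f') /\
    (forall (P : C) (b : Hom P A) (f' : Hom P X),
       is_pullback f a b f' -> K P X f').

(* Fun(0 -> 1, K), as a full subcategory of Fun(0 -> 1, W): the horizontal
   maps of its squares are arbitrary weak equivalences. *)
Definition arrowsIn (M : RelativeCategory) (K : MorClass M) : Category :=
  @fullsub (arrowC (weqC M))
    (fun g => K (src g) (tgt g) (proj1_sig (arr g))).

(* [is_composite c f g]: c and f are composable, and g is f after c. *)
Inductive is_composite (C : Category) : Arrow C -> Arrow C -> Arrow C -> Prop :=
| IsComposite (A B D : C) (c : Hom A B) (f : Hom B D) :
    is_composite (MkArrow c) (MkArrow f) (MkArrow (f \c c)).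

(* The same for squares, which are arrows of the arrow category: the square r
   is obtained by pasting s and t along their common edge w.

       A --c--> B --f--> D
       |u       |w       |v
       A'-c'--> B'-f'--> D'   *)
Inductive is_pasting (C : Category) :
    Arrow (arrowC C) -> Arrow (arrowC C) -> Arrow (arrowC C) -> Prop :=
| IsPasting (A B D A' B' D' : C)
    (c : Hom A B) (f : Hom B D) (c' : Hom A' B') (f' : Hom B' D')
    (u : Hom A A') (w : Hom B B') (v : Hom D D')
    (es : w \c c = c' \c u) (et : v \c f = f' \c w)
    (er : v \c (f \c c) = (f' \c c') \c u) :
    @is_pasting C
      (@MkArrow (arrowC C) (MkArrow c) (MkArrow c') (@MkSquare C (MkArrow c) (MkArrow c') u w es))
      (@MkArrow (arrowC C) (MkArrow f) (MkArrow f') (@MkSquare C (MkArrow f) (MkArrow f') w v et))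
      (@MkArrow (arrowC C) (MkArrow (f \c c)) (MkArrow (f' \c c'))
         (@MkSquare C (MkArrow (f \c c)) (MkArrow (f' \c c')) u v er)).

(* The factorization is functorial: F_f o F_c = id holds for morphisms of
   W and also for the commutative squares of W, which are the morphisms of
   Fun(0 -> 1, W). *)
Definition functorially_factorized (M : RelativeCategory)
    (cof fib : MorClass M) : Prop :=
  exists F : Functor (arrowC (weqC M)) (prodC (arrowsIn cof) (arrowsIn fib)),
    (forall g : arrowC (weqC M),
       is_composite (proj1_sig (F g).1) (proj1_sig (F g).2) g) /\
    (forall (g h : arrowC (weqC M)) (s : Hom g h),
       is_pasting (@MkArrow (arrowC (weqC M)) _ _ (fmap F s).1)
                  (@MkArrow (arrowC (weqC M)) _ _ (fmap F s).2)
                  (@MkArrow (arrowC (weqC M)) _ _ s)).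

Definition partial_model_category (M : RelativeCategory) : Prop :=
  exists cof fib : MorClass M,
    (forall (A B : M) (f : Hom A B), cof A B f -> weq f) /\
    (forall (A B : M) (f : Hom A B), fib A B f -> weq f) /\
    two_out_of_six M /\
    cobase_change_closed cof /\
    base_change_closed fib /\
    functorially_factorized cof fib.

Record Poset := MkPoset {
  pt :> Type;
  ple : pt -> pt -> Prop;
  ple_refl : forall x, ple x x;
  ple_trans : forall x y z, ple x y -> ple y z -> ple x z;
  ple_anti : forall x y, ple x y -> ple y x -> x = y }.

Arguments ple {_} _ _.

Definition posetC (P : Poset) : Category :=
  @MkCategory P (fun x y => ple x y)
    (fun x => ple_refl x)
    (fun x y z g f => ple_trans f g)
    (fun _ _ _ => proof_irrelevance _ _ _)
    (fun _ _ _ => proof_irrelevance _ _ _)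
    (fun _ _ _ _ _ _ _ => proof_irrelevance _ _ _).

Lemma posetC_thin (P : Poset) (x y : posetC P) (f g : Hom x y) : f = g.
Proof. exact: (proof_irrelevance (ple x y)). Qed.

Record Mono (P Q : Poset) := MkMono {
  mfun :> P -> Q;
  mfun_le : forall x y, ple x y -> ple (mfun x) (mfun y) }.

Lemma Mono_eq (P Q : Poset) (f g : Mono P Q) : (forall x, f x = g x) -> f = g.
Proof.
case: f g => [f hf] [g hg] /= e.
have efg : f = g by apply: functional_extensionality.
by subst g; f_equal; exact: proof_irrelevance.
Qed.

Definition mono_id (P : Poset) : Mono P P :=
  @MkMono P P (fun x => x) (fun x y h => h).

Definition mono_cmp (P Q R : Poset) (g : Mono Q R) (f : Mono P Q) : Mono P R :=
  @MkMono P R (fun x => g (f x)) (fun x y h => mfun_le g (mfun_le f h)).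

Definition posetF (P Q : Poset) (f : Mono P Q) :
    Functor (posetC P) (posetC Q) :=
  @MkFunctor (posetC P) (posetC Q) f
    (fun x y h => mfun_le f h)
    (fun _ => posetC_thin _ _) (fun _ _ _ _ _ => posetC_thin _ _).

Definition ordP (n : nat) : Poset.
Proof.
refine (@MkPoset 'I_n.+1 (fun i j => i <= j) _ _ _).
- by move=> i; exact: leqnn.
- by move=> i j k; exact: leq_trans.
- by move=> i j ij ji; apply/val_inj/eqP; rewrite eqn_leq ij ji.
Defined.

(* Simplicial sets: presheaves on the category of the posets
   [n] = {0 < ... < n} and monotone maps. *)

Record SSet := MkSSet {
  simp :> nat -> Type;
  act : forall m n, Mono (ordP m) (ordP n) -> simp n -> simp m;
  act_id : forall n (x : simp n), act (mono_id (ordP n)) x = x;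
  act_cmp : forall k m n (g : Mono (ordP m) (ordP n))
    (f : Mono (ordP k) (ordP m)) (x : simp n),
    act (mono_cmp g f) x = act f (act g x) }.

Arguments act {_ _ _} _ _.

Record SMap (X Y : SSet) := MkSMap {
  sfun :> forall n, X n -> Y n;
  sfun_nat : forall m n (f : Mono (ordP m) (ordP n)) (x : X n),
    sfun (act f x) = act f (sfun x) }.

Lemma SMap_eq (X Y : SSet) (f g : SMap X Y) : (forall n x, f n x = g n x) -> f = g.
Proof.
case: f g => [f hf] [g hg] /= e.
have efg : f = g.
  by apply: functional_extensionality_dep => n;
    apply: functional_extensionality => x.
by subst g; f_equal; exact: proof_irrelevance.
Qed.

Definition smap_cmp (X Y Z : SSet) (g : SMap Y Z) (f : SMap X Y) : SMap X Z.
Proof.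
refine (@MkSMap X Z (fun n x => g n (f n x)) _).
by move=> m n h x; rewrite !sfun_nat.
Defined.

Definition Delta (n : nat) : SSet.
Proof.
by refine (@MkSSet (fun m => Mono (ordP m) (ordP n))
  (fun k m f x => mono_cmp x f) _ _) => *; apply: Mono_eq.
Defined.

(* The horn is the union of the faces d_j, j <> i: its simplices are those
   simplices of Delta n which miss some vertex j <> i. *)
Definition in_horn (n : nat) (i : 'I_n.+1) (m : nat) (x : Delta n m) : Prop :=
  exists j : 'I_n.+1, j <> i /\ forall k : 'I_m.+1, x k <> j.

Lemma in_horn_act n (i : 'I_n.+1) k m (f : Mono (ordP k) (ordP m))
    (x : Delta n m) :
  in_horn i x -> in_horn i (act f x).
Proof. by case=> j [ji xj]; exists j; split=> // l; exact: xj. Qed.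

Definition Horn (n : nat) (i : 'I_n.+1) : SSet.
Proof.
refine (@MkSSet (fun m => {x : Delta n m | in_horn i x})
  (fun k m f x => exist _ (act f (proj1_sig x))
                    (in_horn_act f (proj2_sig x))) _ _).
- by move=> m [x hx]; apply: eq_sig_hprop => /= [*|];
    [exact: proof_irrelevance | exact: Mono_eq].
- by move=> k l m g f [x hx]; apply: eq_sig_hprop => /= [*|];
    [exact: proof_irrelevance | exact: Mono_eq].
Defined.

(* All horns with n >= 1, outer ones included. *)
Definition Kan_complex (X : SSet) : Prop :=
  forall (n : nat) (i : 'I_n.+1) (f : SMap (Horn i) X), 0 < n ->
    exists g : SMap (Delta n) X,
      forall (m : nat) (x : Horn i m), g m (proj1_sig x) = f m x.

Definition nerve (C : Category) : SSet.
Proof.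
refine (@MkSSet (fun n => Functor (posetC (ordP n)) C)
  (fun m n f x => compF x (posetF f)) _ _).
- by move=> n [o m i c]; exact: Functor_eq.
- by move=> k m n g f x; exact: Functor_eq.
Defined.

Definition nerve_map (C D : Category) (G : Functor C D) :
  SMap (nerve C) (nerve D).
Proof.
by refine (@MkSMap (nerve C) (nerve D) (fun n x => compF G x) _) => *;
  apply: Functor_eq.
Defined.

(* Kan's subdivision of the standard simplices.  A non-degenerate simplex of
   Delta n is an injective monotone map [m] -> [n]; it is determined by its
   image, which is an arbitrary nonempty set of vertices, and it is a face of
   another one iff its image is contained in that of the other. *)

Definition faceP (n : nat) : Poset.
Proof.
refine (@MkPoset {S : {set 'I_n.+1} | S != set0}
  (fun S T => val S \subset val T) _ _ _).
- by move=> S; exact: subxx.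
- by move=> S T U; exact: subset_trans.
- by move=> S T ST TS; apply/val_inj/eqP; rewrite eqEsubset ST TS.
Defined.

Lemma image_neq0 m n (f : 'I_m.+1 -> 'I_n.+1) (S : {set 'I_m.+1}) :
  S != set0 -> f @: S != set0.
Proof. by case/set0Pn=> x Sx; apply/set0Pn; exists (f x); exact: imset_f. Qed.

Definition face_map m n (f : Mono (ordP m) (ordP n)) : Mono (faceP m) (faceP n).
Proof.
refine (@MkMono (faceP m) (faceP n)
  (fun S => exist _ ((f : 'I_m.+1 -> 'I_n.+1) @: sval S)
              (image_neq0 f (valP S))) _).
by move=> S T; exact: imsetS.
Defined.

Definition SdDelta (n : nat) : SSet := nerve (posetC (faceP n)).

Definition SdDelta_map m n (f : Mono (ordP m) (ordP n)) :
    SMap (SdDelta m) (SdDelta n) :=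
  nerve_map (posetF (face_map f)).

Lemma posetF_eq (C : Category) (P : Poset) (F G : Functor C (posetC P)) :
  (forall x, F x = G x) -> F = G.
Proof.
case: F G => [o m i c] [o' m' i' c'] /= e.
have eo : o = o' by apply: functional_extensionality.
subst o'; apply: Functor_eq.
apply: functional_extensionality_dep => A.
apply: functional_extensionality_dep => B.
by apply: functional_extensionality => f; exact: posetC_thin.
Qed.

Lemma SdDelta_map_id n m (s : SdDelta n m) :
  SdDelta_map (mono_id (ordP n)) m s = s.
Proof. by apply: posetF_eq => k; apply: val_inj; rewrite /= imset_id. Qed.

Lemma SdDelta_map_cmp k m n (g : Mono (ordP m) (ordP n))
    (f : Mono (ordP k) (ordP m)) l (s : SdDelta k l) :
  SdDelta_map (mono_cmp g f) l s = SdDelta_map g l (SdDelta_map f l s).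
Proof. by apply: posetF_eq => j; apply: val_inj; rewrite /= imset_comp. Qed.

(* Sd being the colimit-preserving extension of SdDelta, an n-simplex
   Delta n -> Ex X of its right adjoint Ex amounts to a map SdDelta n -> X. *)
Definition Ex (X : SSet) : SSet.
Proof.
refine (@MkSSet (fun n => SMap (SdDelta n) X)
  (fun m n f s => smap_cmp s (SdDelta_map f)) _ _).
- move=> n s; apply: SMap_eq => m x; exact: (f_equal (s m) (SdDelta_map_id x)).
- move=> k m n g f s; apply: SMap_eq => l x;
    exact: (f_equal (s l) (SdDelta_map_cmp g f x)).
Defined.

Definition Thomason_fibrant (D : Category) : Prop :=
  Kan_complex (Ex (Ex (nerve D))).

(* Main.v *)
From mathcomp Require Import all_boot.
From Stdlib Require Import FunctionalExtensionality ProofIrrelevance.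
From Stdlib Require Import ClassicalEpsilon.
Require Import Defs.

Set Implicit Arguments.
Unset Strict Implicit.
Unset Printing Implicit Defensive.

(** Why the category W of weak equivalences of a partial model category is
    fibrant.

    By two out of three, W inherits enough of the structure of the ambient
    category: each of its morphisms is a cofibration followed by a fibration,
    and W has pushouts along cofibrations and pullbacks along fibrations
    ([weqC_factorization_classes]).  Every category C with such classes is
    fibrant ([factorization_fibrant]).

    A horn in Ex^2 N C amounts to a functor X on the poset K of the nonempty
    chains of faces of the horn ([horn_descent], [nerve_full]), and a filler to
    an extension of X to the poset of all nonempty chains of faces of the
    simplex.  A chain that meets the horn has a trace on it, which is an
    element of K; hence X extends as soon as there are natural transformations
    X -> Y <- L with L constant: use X on K, use Y of the trace on the other
    chains that meet the horn, and L on the chains that miss it ([extension]).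
    Call X null if such a cospan exists.

    Constant functors are null, and if X -> X' is natural, nullity passes from
    X' to X.  It also passes from X to X' ([null_post]): if all the components
    of X -> Y are cofibrations, push them out along X -> X'.  They can be made
    cofibrations because K is finite ([null_cof]): in decreasing order of q,
    factor X q -> Y q as a cofibration followed by a fibration Z -> Y q, then
    pull back along Z -> Y q the object L and all the Y r with r <= q.  So
    nullity is invariant under zigzags of natural transformations.

    Finally the identity of K is joined to a constant map by a zigzag of
    monotone maps.  On the faces of the horn with vertex i there is the conical
    contraction S <= S + i >= {i}.  Two comparable maps of faces f <= g need not
    induce comparable maps of chains, but one may pass from f to g one
    cardinality at a time; a chain contains at most one face of each
    cardinality, so the images of a chain under two consecutive stages have a
    chain as their union ([null_homotopic], [null_horn]). *)

Notation cid := (constructive_indefinite_description _).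

(** * Universal constructions as data *)

Record Pullback (C : Category) (A B X : C) (f : Hom A B) (a : Hom X B) := {
  pb_ob : C;
  pb_fst : Hom pb_ob A;
  pb_snd : Hom pb_ob X;
  pb_comm : f \c pb_fst = a \c pb_snd;
  pb_lift : forall (Q : C) (h : Hom Q A) (k : Hom Q X),
    f \c h = a \c k -> Hom Q pb_ob;
  pb_lift_fst : forall Q h k e, pb_fst \c @pb_lift Q h k e = h;
  pb_lift_snd : forall Q h k e, pb_snd \c @pb_lift Q h k e = k;
  pb_ext : forall (Q : C) (u v : Hom Q pb_ob),
    pb_fst \c u = pb_fst \c v -> pb_snd \c u = pb_snd \c v -> u = v }.

Record Pushout (C : Category) (A B X : C) (f : Hom A B) (a : Hom A X) := {
  po_ob : C;
  po_fst : Hom B po_ob;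
  po_snd : Hom X po_ob;
  po_comm : po_fst \c f = po_snd \c a;
  po_desc : forall (Q : C) (h : Hom B Q) (k : Hom X Q),
    h \c f = k \c a -> Hom po_ob Q;
  po_desc_fst : forall Q h k e, @po_desc Q h k e \c po_fst = h;
  po_desc_snd : forall Q h k e, @po_desc Q h k e \c po_snd = k;
  po_ext : forall (Q : C) (u v : Hom po_ob Q),
    u \c po_fst = v \c po_fst -> u \c po_snd = v \c po_snd -> u = v }.

Lemma PullbackI (C : Category) (A B X : C) (f : Hom A B) (a : Hom X B) :
  (exists (P : C) (b : Hom P A) (f' : Hom P X), is_pullback f a b f') ->
  Pullback f a.
Proof.
move=> /cid[P] /cid[b] /cid[f' [e ump]].
exists P b f' (fun Q h k ehk => proj1_sig (cid (ump Q h k ehk))) => //.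
- by move=> Q h k ehk; case: cid => u [] [].
- by move=> Q h k ehk; case: cid => u [] [].
- move=> Q u v eb ef.
  have ehk : f \c (b \c u) = a \c (f' \c u) by rewrite !cmp_assoc e.
  have [w [_ uniq]] := ump _ _ _ ehk.
  by rewrite -(uniq u) // -(uniq v).
Qed.

Lemma PushoutI (C : Category) (A B X : C) (f : Hom A B) (a : Hom A X) :
  (exists (P : C) (b : Hom B P) (f' : Hom X P), is_pushout f a b f') ->
  Pushout f a.
Proof.
move=> /cid[P] /cid[b] /cid[f' [e ump]].
exists P b f' (fun Q h k ehk => proj1_sig (cid (ump Q h k ehk))) => //.
- by move=> Q h k ehk; case: cid => u [] [].
- by move=> Q h k ehk; case: cid => u [] [].
- move=> Q u v eb ef.
  have ehk : (u \c b) \c f = (u \c f') \c a by rewrite -!cmp_assoc e.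
  have [w [_ uniq]] := ump _ _ _ ehk.
  by rewrite -(uniq u) // -(uniq v).
Qed.

(** * The category of weak equivalences *)

Record factorization_classes (C : Category) (cof fib : MorClass C) : Prop := {
  factorization : forall (A B : C) (g : Hom A B),
    exists (E : C) (c : Hom A E) (p : Hom E B),
      [/\ cof A E c, fib E B p & p \c c = g];
  cof_pushout : forall (A B X : C) (f : Hom A B) (a : Hom A X), cof A B f ->
    exists (P : C) (b : Hom B P) (f' : Hom X P), is_pushout f a b f';
  fib_pullback : forall (A B X : C) (f : Hom A B) (a : Hom X B), fib A B f ->
    exists (P : C) (b : Hom P A) (f' : Hom P X), is_pullback f a b f' }.

Lemma is_composite_factors (C : Category) (K1 K2 : MorClass C)
    (c p g : Arrow C) :
  is_composite c p g -> K1 _ _ (arr c) -> K2 _ _ (arr p) ->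
  exists (E : C) (c' : Hom (src g) E) (p' : Hom E (tgt g)),
    [/\ K1 _ _ c', K2 _ _ p' & p' \c c' = arr g].
Proof. by case=> A E B c' p' /= *; exists E, c', p'. Qed.

Section WeakEquivalences.
Variable M : RelativeCategory.

Lemma weqC_eq (A B : weqC M) (f g : Hom A B) :
  proj1_sig f = proj1_sig g -> f = g.
Proof.
by move=> e; apply: eq_sig_hprop => //= *; exact: proof_irrelevance.
Qed.

Hypothesis two6 : two_out_of_six M.

Lemma weq_cancel_right (A B C : M) (f : Hom A B) (g : Hom B C) :
  weq f -> weq (g \c f) -> weq g.
Proof.
by move=> wf wgf; case: (@two6 _ _ _ _ (idm A) f g); rewrite ?cmp_idr.
Qed.

Lemma weq_cancel_left (A B C : M) (f : Hom A B) (g : Hom B C) :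
  weq g -> weq (g \c f) -> weq f.
Proof.
by move=> wg wgf; case: (@two6 _ _ _ _ f g (idm C)); rewrite ?cmp_idl.
Qed.

End WeakEquivalences.

(** A cone of weak equivalences over a pullback of weak equivalences along a
    fibration is induced by a weak equivalence, by two out of three; so these
    pullbacks, and dually the pushouts along cofibrations, have their
    universal property also within the category of weak equivalences. *)
Lemma weqC_factorization_classes (M : RelativeCategory) :
  partial_model_category M ->
  exists cof fib : MorClass (weqC M), factorization_classes cof fib.
Proof.
case=> cof [fib] [cofW] [fibW] [two6] [cofP] [fibP] [F [Fcomp _]].
exists (fun A B f => cof A B (proj1_sig f)).
exists (fun A B f => fib A B (proj1_sig f)).
split.
- move=> A B g.
  exact: (@is_composite_factors (weqC M)
    (fun A B f => cof A B (proj1_sig f)) (fun A B f => fib A B (proj1_sig f))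
    _ _ _ (Fcomp (MkArrow g)) (proj2_sig (F (MkArrow g)).1)
    (proj2_sig (F (MkArrow g)).2)).
- move=> A B X [f wf] [a wa] /= coff.
  have [[P [b [f' [e ump]]]] /(_ _ _ _ (conj _ _)) stab] := cofP _ _ X f a coff.
  have wf' : weq f' by apply: cofW; exact: stab ump.
  have wb : weq b.
    by apply: (weq_cancel_right two6 wf); rewrite e; exact: weq_cmp.
  exists P, (exist _ b wb), (exist _ f' wf'); split; first exact: weqC_eq.
  move=> Q [h wh] [k wk] /(f_equal (@proj1_sig _ _))/= ehk.
  have [u [[ub uf'] uniq]] := ump Q h k ehk.
  have wu : weq u by apply: (weq_cancel_right two6 wf'); rewrite uf'.
  exists (exist _ u wu); split; first by split; exact: weqC_eq.
  case=> v wv [/(f_equal (@proj1_sig _ _))/= vb /(f_equal (@proj1_sig _ _))/= vf'].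
  by apply: weqC_eq => /=; exact: uniq.
- move=> A B X [f wf] [a wa] /= fibf.
  have [[P [b [f' [e ump]]]] /(_ _ _ _ (conj _ _)) stab] := fibP _ _ X f a fibf.
  have wf' : weq f' by apply: fibW; exact: stab ump.
  have wb : weq b.
    by apply: (weq_cancel_left two6 wf); rewrite e; exact: weq_cmp.
  exists P, (exist _ b wb), (exist _ f' wf'); split; first exact: weqC_eq.
  move=> Q [h wh] [k wk] /(f_equal (@proj1_sig _ _))/= ehk.
  have [u [[ub uf'] uniq]] := ump Q h k ehk.
  have wu : weq u by apply: (weq_cancel_left two6 wf'); rewrite uf'.
  exists (exist _ u wu); split; first by split; exact: weqC_eq.
  case=> v wv [/(f_equal (@proj1_sig _ _))/= vb /(f_equal (@proj1_sig _ _))/= vf'].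
  by apply: weqC_eq => /=; exact: uniq.
Qed.

(** * Null diagrams *)

Definition natural (C D : Category) (F G : Functor C D)
    (a : forall x, Hom (F x) (G x)) :=
  forall (x y : C) (h : Hom x y), a y \c fmap F h = fmap G h \c a x.

Definition is_cone (C D : Category) (F : Functor C D) (L : D)
    (b : forall x, Hom L (F x)) :=
  forall (x y : C) (h : Hom x y), fmap F h \c b x = b y.

(** A cospan of natural transformations from [F] to a constant functor. *)
Record Null (C D : Category) (F : Functor C D) := MkNull {
  null_dgm : Functor C D;
  null_apex : D;
  null_map : forall x, Hom (F x) (null_dgm x);
  null_cone : forall x, Hom null_apex (null_dgm x);
  null_map_nat : natural null_map;
  null_cone_nat : is_cone null_cone }.

Definition constF (C D : Category) (d : D) : Functor C D.
Proof.
refine (@MkFunctor C D (fun=> d) (fun _ _ _ => idm d) _ _) => //.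
by move=> *; rewrite cmp_idl.
Defined.

Lemma null_const (C D : Category) (d : D) : Null (constF C d).
Proof.
by exists (constF C d) d (fun=> idm d) (fun=> idm d) => x y h; rewrite /= ?cmp_idl.
Qed.

Lemma null_pre (C D : Category) (F F' : Functor C D)
    (a : forall x, Hom (F x) (F' x)) :
  natural a -> Null F' -> Null F.
Proof.
move=> a_nat [G L g b g_nat b_cone].
exists G L (fun x => g x \c a x) b => // x y h.
by rewrite -cmp_assoc a_nat !cmp_assoc g_nat.
Qed.

Section Diagrams.
Variables (C : Category) (cof fib : MorClass C).
Hypothesis CF : factorization_classes cof fib.
Variable K : Poset.

Section RestrictedPullback.
Variables (Y : Functor (posetC K) C) (q : K) (Z : C) (p : Hom Z (Y q)).
Hypothesis fibp : fib p.

(** The fibre product over [Y q] of [Y r] and [Z] if [r] lies below [q], and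
    [Y r] itself otherwise; one universal property covers both cases, so that no
    case analysis enters the functor that these objects form.  The last two
    fields say that [Y r] is kept on the nose away from [q], and that [Z] itself
    is taken at [q]; objects isomorphic to them would not do, because
    [factorization_classes] does not make cofibrations stable under
    isomorphism. *)
Record Restr (r : K) := {
  rs_ob : C;
  rs_fst : Hom rs_ob (Y r);
  rs_snd : ple r q -> Hom rs_ob Z;
  rs_comm : forall h : @Hom (posetC K) r q, fmap Y h \c rs_fst = p \c rs_snd h;
  rs_lift : forall (T : C) (t : Hom T (Y r)) (w : ple r q -> Hom T Z),
    (forall h : @Hom (posetC K) r q, fmap Y h \c t = p \c w h) -> Hom T rs_ob;
  rs_lift_fst : forall T t w e, rs_fst \c @rs_lift T t w e = t;
  rs_lift_snd : forall T t w e h, rs_snd h \c @rs_lift T t w e = w h;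
  rs_ext : forall (T : C) (u v : Hom T rs_ob),
    rs_fst \c u = rs_fst \c v -> (forall h, rs_snd h \c u = rs_snd h \c v) ->
    u = v;
  rs_cof_away : ~ ple r q -> forall (A : C) (u : Hom A rs_ob),
    cof (rs_fst \c u) -> cof u;
  rs_cof_at : r = q -> forall (h : ple r q) (A : C) (u : Hom A rs_ob),
    cof (rs_snd h \c u) -> cof u }.

Lemma restr_exists r : Restr r.
Proof.
case: (excluded_middle_informative (r = q)) => [->|nrq].
  unshelve eexists Z p (fun=> idm Z) (fun _ _ w _ => w (ple_refl q)).
  - by move=> h; rewrite (posetC_thin h (idm _)) fmap_id cmp_idl cmp_idr.
  - move=> T t w e /=; rewrite -e -[RHS]cmp_idl -fmap_id.
    by [].
  - by move=> T t w e h; rewrite cmp_idl; f_equal; exact: proof_irrelevance.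
  - by move=> T u v _ /(_ (ple_refl q)); rewrite !cmp_idl.
  - by move/(_ (ple_refl q)).
  - by move=> _ _ A u; rewrite cmp_idl.
case: (excluded_middle_informative (ple r q)) => [rq|nle].
  have [P b c e lift liftb liftc ext] :=
    PullbackI (@fib_pullback _ _ _ CF _ _ _ p (fmap Y (rq : @Hom (posetC K) r q)) fibp).
  have thin (h : @Hom (posetC K) r q) : h = rq by exact: posetC_thin.
  unshelve eexists P c (fun=> b) _.
  - move=> T t w ew; apply: (lift T (w rq) t); rewrite ew //.
  - by move=> h; rewrite (thin h) e.
  - by move=> T t w ew; rewrite liftc.
  - by move=> T t w ew h; rewrite liftb; f_equal; exact: proof_irrelevance.
  - by move=> T u v ec /(_ rq) eb; exact: ext.
  - by move=> nle; case: nle.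
  - by move=> erq; case: nrq.
unshelve eexists (Y r) (idm _) (fun h => False_rect _ (nle h)) (fun _ t _ _ => t).
- by move=> h; case: (nle h).
- by move=> T t w e; rewrite cmp_idl.
- by move=> T t w e h; case: (nle h).
- by move=> T u v; rewrite !cmp_idl.
- by move=> _ A u; rewrite cmp_idl.
- by [].
Qed.

Lemma restr_functor_compat r s (R : Restr r) (rs : @Hom (posetC K) r s)
    (h : @Hom (posetC K) s q) :
  fmap Y h \c (fmap Y rs \c rs_fst R) = p \c rs_snd R (ple_trans rs h).
Proof.
by rewrite cmp_assoc -fmap_cmp -rs_comm; f_equal; f_equal; exact: posetC_thin.
Qed.

Definition restr_functor : Functor (posetC K) C.
Proof.
refine (@MkFunctor (posetC K) C (fun r => rs_ob (restr_exists r))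
  (fun r s rs => rs_lift (restr_exists s)
    (restr_functor_compat (restr_exists r) rs)) _ _).
- move=> r; apply: rs_ext => [|h].
    by rewrite rs_lift_fst fmap_id cmp_idl cmp_idr.
  by rewrite rs_lift_snd cmp_idr; f_equal; exact: proof_irrelevance.
- move=> r s t st rs; apply: rs_ext => [|h].
    by rewrite cmp_assoc !rs_lift_fst -cmp_assoc rs_lift_fst fmap_cmp cmp_assoc.
  by rewrite cmp_assoc !rs_lift_snd; f_equal; exact: proof_irrelevance.
Defined.

End RestrictedPullback.

Section Refine.
Variable X : Functor (posetC K) C.

Definition cof_at (N : Null X) (r : K) := cof (null_map N r).

(** A component X q -> Y q becomes a cofibration once Y is pulled back, below
    [q], along the fibration through which the component factors.  Away from
    the elements below [q] nothing changes. *)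
Lemma null_cof_step (N : Null X) (q : K) :
  exists N' : Null X, cof_at N' q /\
    forall r, ~ ple r q -> cof_at N r -> cof_at N' r.
Proof.
case: N => Y L a b a_nat b_cone.
have [Z [c [p [cofc fibp epc]]]] := factorization CF (a q).
have [L' l1 l2 el _ _ _ _] := PullbackI (fib_pullback CF (b q) fibp).
pose R := restr_exists fibp.
have a_compat r (h : @Hom (posetC K) r q) :
    fmap Y h \c a r = p \c (c \c fmap X h) by rewrite cmp_assoc epc a_nat.
have b_compat r (h : @Hom (posetC K) r q) :
    fmap Y h \c (b r \c l2) = p \c l1 by rewrite cmp_assoc b_cone el.
pose a' r := rs_lift (R r) (a_compat r).
pose b' r := rs_lift (R r) (b_compat r).
have a'_nat : @natural _ _ X (restr_functor fibp) a'.
  move=> r s rs; apply: rs_ext => [|h] /=.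
    by rewrite cmp_assoc rs_lift_fst [RHS]cmp_assoc rs_lift_fst -cmp_assoc rs_lift_fst.
  rewrite cmp_assoc rs_lift_snd [RHS]cmp_assoc !rs_lift_snd.
  by rewrite -cmp_assoc -fmap_cmp; do 2 f_equal; exact: posetC_thin.
have b'_cone : @is_cone _ _ (restr_functor fibp) L' b'.
  move=> r s rs; apply: rs_ext => [|h] /=.
    by rewrite cmp_assoc !rs_lift_fst -cmp_assoc rs_lift_fst cmp_assoc b_cone.
  by rewrite cmp_assoc !rs_lift_snd.
exists (MkNull a'_nat b'_cone); rewrite /cof_at; split=> [|r nle] /=.
  apply: (@rs_cof_at _ _ _ _ _ (R q) erefl (ple_refl q)); rewrite /=.
  by rewrite rs_lift_snd (fmap_id X q) cmp_idr.
by move=> cofa; apply: rs_cof_away => //; rewrite rs_lift_fst.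
Qed.


(** The list [e] is a decreasing linear extension: no element lies strictly
    below a later one.  So no element already treated lies strictly below the
    current one, and its component remains a cofibration. *)
Lemma null_cof (e : seq K) :
  List.ForallOrdPairs (fun x y => ple x y -> x = y) e ->
  (forall x, List.In x e) -> Null X -> exists N : Null X, forall x, cof_at N x.
Proof.
move=> ord_e all_e N0.
suff [N cofN] : exists N : Null X, forall x, List.In x e -> cof_at N x.
  by exists N => x; exact: cofN.
have: forall done : K -> Prop, (forall x, done x -> cof_at N0 x) ->
    (forall x y, done x -> List.In y e -> ple x y -> x = y) ->
    exists N : Null X, forall x, done x \/ List.In x e -> cof_at N x.
  elim: {all_e} e ord_e N0 => [|q e IHe] ord_e N done cofN ltN.
    by exists N => x [|[]]; exact: cofN.
  have [ltq ord_e'] : List.Forall (fun y => ple q y -> q = y) e /\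
      List.ForallOrdPairs (fun x y : K => ple x y -> x = y) e.
    by inversion ord_e.
  have [N' [cofq cofr]] := null_cof_step N q.
  have [x /= dx|x y dx /= ey xy|N'' cofN''] :=
      IHe ord_e' N' (fun x => done x \/ x = q).
  - have [->|nxq] := excluded_middle_informative (x = q); first exact: cofq.
    case: dx => // dx; apply: cofr; last exact: cofN.
    by move=> xq; apply: nxq; apply: ltN dx _ xq; left.
  - case: dx xy => [dx xy|-> qy].
      by apply: ltN dx _ xy; right.
    by have /List.Forall_forall/(_ y ey)/(_ qy) := ltq.
  - by exists N'' => x [dx|[<-|ex]]; apply: cofN''; [left; left|left; right|right].
case/(_ (fun _ => False)) => [//|//|N cofN].
by exists N => x ex; apply: cofN; right.
Qed.

End Refine.

(** With cofibrations as components of X -> Y, the pointwise pushouts of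
    X' <- X -> Y exist, and they form the new diagram Y'. *)
Lemma null_post (e : seq K) (X X' : Functor (posetC K) C)
    (a : forall x, Hom (X x) (X' x)) :
  List.ForallOrdPairs (fun x y => ple x y -> x = y) e ->
  (forall x, List.In x e) -> natural a -> Null X -> Null X'.
Proof.
move=> ord_e all_e a_nat N.
have {N} [[Y L g b g_nat b_cone] cofg] := cid (null_cof ord_e all_e N).
pose P x := PushoutI (cof_pushout CF (a x) (cofg x : cof (g x))).
have P_compat x y (h : @Hom (posetC K) x y) :
    (po_fst (P y) \c fmap Y h) \c g x = (po_snd (P y) \c fmap X' h) \c a x.
  by rewrite -!cmp_assoc -g_nat -a_nat !cmp_assoc po_comm.
unshelve eexists (@MkFunctor (posetC K) C (fun x => po_ob (P x))
   (fun x y h => po_desc (P x) (P_compat x y h)) _ _) L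
   (fun x => po_snd (P x)) (fun x => po_fst (P x) \c b x).
- move=> x; apply: po_ext; rewrite ?po_desc_fst ?po_desc_snd !fmap_id;
    by rewrite cmp_idl cmp_idr.
- move=> x y z h h'; apply: po_ext.
    by rewrite po_desc_fst -cmp_assoc po_desc_fst cmp_assoc po_desc_fst
      -cmp_assoc -fmap_cmp.
  by rewrite po_desc_snd -cmp_assoc po_desc_snd cmp_assoc po_desc_snd
    -cmp_assoc -fmap_cmp.
- by move=> x y h /=; rewrite po_desc_snd.
- by move=> x y h /=; rewrite cmp_assoc po_desc_fst -cmp_assoc b_cone.
Qed.

End Diagrams.

(** * Functors on a poset and maps between nerves *)

(** Packing a morphism with its endpoints allows comparing morphisms whose
    endpoints are equal without being convertible. *)
Lemma MkArrow_inj (C : Category) (A B : C) (f g : Hom A B) :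
  MkArrow f = MkArrow g -> f = g.
Proof.
move=> e; inversion e as [H].
by have := inj_pair2 _ _ _ _ _ (inj_pair2 _ _ _ _ _ H).
Qed.

Lemma MkArrow_cmp (C : Category) (A B D A' B' D' : C) (f : Hom A B)
    (g : Hom B D) (f' : Hom A' B') (g' : Hom B' D') :
  MkArrow f = MkArrow f' -> MkArrow g = MkArrow g' ->
  MkArrow (g \c f) = MkArrow (g' \c f').
Proof.
move=> ef eg.
have eA : A = A' := f_equal (@src _) ef.
have eB : B = B' := f_equal (@tgt _) ef.
have eD : D = D' := f_equal (@tgt _) eg.
by subst A' B' D'; rewrite (MkArrow_inj ef) (MkArrow_inj eg).
Qed.

Lemma functor_eq_arrows (D C : Category) (F G : Functor D C) :
  (forall (x y : D) (h : Hom x y), MkArrow (fmap F h) = MkArrow (fmap G h)) ->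
  F = G.
Proof.
case: F G => [o m i c] [o' m' i' c'] /= e.
have eo : o = o'.
  by apply: functional_extensionality => x; exact: (f_equal (@src _) (e x x (idm x))).
subst o'; apply: Functor_eq.
apply: functional_extensionality_dep => x.
apply: functional_extensionality_dep => y.
by apply: functional_extensionality => h; exact: MkArrow_inj.
Qed.

Definition simplex (Q : Poset) (l : nat) (v : 'I_l.+1 -> Q)
    (v_le : forall i j : 'I_l.+1, i <= j -> ple (v i) (v j)) :
    nerve (posetC Q) l :=
  @MkFunctor (posetC (ordP l)) (posetC Q) v v_le
    (fun _ => posetC_thin _ _) (fun _ _ _ _ _ => posetC_thin _ _).

Definition pair_fun (T : Type) (x y : T) (i : 'I_2) : T :=
  if val i is 0 then x else y.

Lemma pair_fun_le (Q : Poset) (x y : Q) : ple x y ->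
  forall i j : 'I_2, i <= j -> ple (pair_fun x y i) (pair_fun x y j).
Proof.
move=> xy [[|i] ?] [[|j] ?] //= _; by [exact: ple_refl | exact: xy].
Qed.

Definition edge (Q : Poset) (x y : Q) (xy : ple x y) : nerve (posetC Q) 1 :=
  simplex (pair_fun_le xy).

Lemma edge_irr (Q : Poset) (x y : Q) (e e' : ple x y) : edge e = edge e'.
Proof. exact: posetF_eq. Qed.

Definition edge_arrow (C : Category) (F : nerve C 1) : Arrow C :=
  MkArrow (fmap F (isT : @Hom (posetC (ordP 1)) ord0 ord_max)).

Section NerveFull.
Variables (Q : Poset) (C : Category).
Variable phi : SMap (nerve (posetC Q)) (nerve C).

(** By naturality along the edge p <= q of [l], a map of nerves is determined
    by its values on edges. *)
Lemma nerve_map_edge l (v : nerve (posetC Q) l) (p q : posetC (ordP l))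
    (pq : Hom p q) :
  MkArrow (fmap (phi l v) pq) = edge_arrow (phi 1 (edge (fmap v pq))).
Proof.
pose th : Mono (ordP 1) (ordP l) :=
  @MkMono (ordP 1) (ordP l) (pair_fun p q) (@pair_fun_le (ordP l) p q pq).
have -> : edge (fmap v pq) = act th v.
  by apply: posetF_eq => -[[|j] jlt].
rewrite sfun_nat /edge_arrow /=.
by congr (MkArrow (fmap (phi l v) _)); exact: posetC_thin.
Qed.

Let ob (x : Q) : C := phi 1 (edge (ple_refl x)) ord0.

Lemma nerve_map_vertex l (v : nerve (posetC Q) l) (p : ordP l) :
  phi l v p = ob (v p).
Proof.
have := f_equal (@src _) (nerve_map_edge v (ple_refl p)); rewrite /= => ->.
by rewrite /ob (edge_irr _ (ple_refl (v p))).
Qed.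

Lemma nerve_map_hom x y (xy : ple x y) :
  {g : Hom (ob x) (ob y) | MkArrow g = edge_arrow (phi 1 (edge xy))}.
Proof.
apply: cid; rewrite /edge_arrow.
move: (fmap _ _) => g.
by move: g (nerve_map_vertex (edge xy) ord0) (nerve_map_vertex (edge xy) ord_max);
  rewrite /= => g ex ey; move: g; rewrite ex ey => g; exists g.
Qed.

Let edges_irr x y (e e' : ple x y) :
  edge_arrow (phi 1 (edge e)) = edge_arrow (phi 1 (edge e')).
Proof. by rewrite (edge_irr e e'). Qed.

(** Functoriality is read off from the value on the triangle x <= y <= z. *)
Lemma nerve_full : exists G : Functor (posetC Q) C,
  forall l v, phi l v = compF G v.
Proof.
unshelve eexists.
  refine (@MkFunctor (posetC Q) C ob
    (fun x y xy => proj1_sig (nerve_map_hom xy)) _ _).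
  - move=> x; case: nerve_map_hom => g /= eg; apply: MkArrow_inj; rewrite eg.
    rewrite /ob -(fmap_id (phi 1 (edge (ple_refl x)))) nerve_map_edge.
    exact: edges_irr.
  - move=> x y z yz xy.
    case: nerve_map_hom => g eg; case: nerve_map_hom => h eh.
    case: nerve_map_hom => k ek; apply: MkArrow_inj; rewrite eg.
    pose v (i : 'I_3) := match val i with 0 => x | 1 => y | _ => z end.
    have v_le (i j : 'I_3) : i <= j -> ple (v i) (v j).
      move: i j => [[|[|i]] ?] [[|[|j]] ?] //= ij;
        by [exact: ple_refl | exact: xy | exact: yz | exact: ple_trans xy yz
           | case/negP: ij].
    pose t := simplex v_le.
    pose e01 : @Hom (posetC (ordP 2)) ord0 (@Ordinal 3 1 isT) := isT.
    pose e12 : @Hom (posetC (ordP 2)) (@Ordinal 3 1 isT) ord_max := isT.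
    transitivity (MkArrow (fmap (phi 2 t) (e12 \c e01))).
      by rewrite nerve_map_edge; exact: edges_irr.
    rewrite fmap_cmp; apply: MkArrow_cmp.
      by rewrite ek nerve_map_edge; exact: edges_irr.
    by rewrite eh nerve_map_edge; exact: edges_irr.
move=> l v; apply: functor_eq_arrows => p q pq.
by rewrite nerve_map_edge /=; case: nerve_map_hom => g /= ->.
Qed.

End NerveFull.

(** * Chains of faces *)

Notation faceT n := {S : {set 'I_n.+1} | S != set0}.

Lemma face_map_id n (r : Mono (ordP n) (ordP n)) (S : faceP n) :
  (forall a, a \in val S -> r a = a) -> face_map r S = S.
Proof.
move=> fixS; apply: val_inj; rewrite /=.
by rewrite (eq_in_imset (g := id)) ?imset_id // => a aS; exact: fixS.
Qed.

(** Send [a] to the largest element of [S] that is at most [a], or to the least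
    element of [S] if there is none. *)
Lemma face_retraction n (S : faceP n) : exists r : Mono (ordP n) (ordP n),
  (forall a, r a \in val S) /\ forall a, a \in val S -> r a = a.
Proof.
case: S => S /= S_neq0; have [b0 b0S] := set0Pn _ S_neq0.
(* The second case keeps D a nonempty when a lies below all of S. *)
pose D (a b : 'I_n.+1) :=
  (b \in S) && ((b <= a) || [forall t in S, b <= t]).
have [bm bmS bm_min] := @arg_minnP _ b0 (mem S) (fun b : 'I_n.+1 => b : nat) b0S.
have {}bmS : bm \in S := bmS.
have Dbm a : D a bm.
  by rewrite /D bmS; apply/orP; right; apply/forall_inP => t; exact: bm_min.
pose r (a : 'I_n.+1) := [arg max_(b > bm | D a b) (b : nat)].
have rP a : D a (r a) /\ forall b, D a b -> b <= r a.
  by rewrite /r; case: arg_maxnP => //; exact: Dbm.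
have r_le (a b : ordP n) : ple a b -> @ple (ordP n) (r a) (r b).
  move=> ab; apply: (rP b).2; case/andP: (rP a).1 => rS /orP[ra|rm].
    by rewrite /D rS (leq_trans ra ab).
  by rewrite /D rS rm orbT.
exists (MkMono r_le); split=> a /=; first by case/andP: (rP a).1.
move=> aS; apply/val_inj/eqP; rewrite eqn_leq (rP a).2 ?andbT; last first.
  by rewrite /D aS leqnn.
by case/andP: (rP a).1 => _ /orP[//|/forall_inP/(_ a aS)].
Qed.

Definition is_chain n (c : {set faceT n}) :=
  [forall S in c, forall T in c,
     (val S \subset val T) || (val T \subset val S)].

Lemma is_chainP n (c : {set faceT n}) :
  reflect (forall S T : faceP n, S \in c -> T \in c -> ple S T \/ ple T S)
          (is_chain c).
Proof.
apply: (iffP forall_inP) => [ch S T Sc Tc|ch S Sc].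
  by apply/orP; have /forall_inP := ch S Sc; exact.
by apply/forall_inP => T Tc; apply/orP; exact: ch.
Qed.

Definition chain_on n (H c : {set faceT n}) :=
  [&& c != set0, c \subset H & is_chain c].

Definition chainP n (H : {set faceT n}) : Poset.
Proof.
refine (@MkPoset {c : {set faceT n} | chain_on H c}
  (fun c d => val c \subset val d) _ _ _).
- by move=> c; exact: subxx.
- by move=> c d e; exact: subset_trans.
- by move=> c d cd dc; apply/val_inj/eqP; rewrite eqEsubset cd dc.
Defined.

Lemma chain_cmp n (H : {set faceT n}) (c : chainP H) (S T : faceP n) :
  S \in val c -> T \in val c -> ple S T \/ ple T S.
Proof. by case: c => c /= /and3P[_ _ /is_chainP]; exact. Qed.

Lemma chain_in n (H : {set faceT n}) (c : chainP H) (S : faceP n) :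
  S \in val c -> S \in H.
Proof. by case: c => c /= /and3P[_ /subsetP cH _]; exact: cH. Qed.

Lemma chain_neq0 n (H : {set faceT n}) (c : chainP H) : val c != set0.
Proof. by case: c => c /= /and3P[]. Qed.

Lemma mono_chain k n (H : {set faceT n}) (s : SdDelta n k) (T : faceP k) :
  (forall b, s b \in H) ->
  chain_on H ((s : 'I_k.+1 -> faceT n) @: val T).
Proof.
move=> sH; have /set0Pn[a aT] := valP T.
apply/and3P; split; first by apply/set0Pn; exists (s a); exact: imset_f.
  by apply/subsetP => _ /imsetP[b _ ->]; exact: sH.
apply/is_chainP => _ _ /imsetP[a' _ ->] /imsetP[b _ ->].
by case/orP: (leq_total a' b) => ab; [left|right];
  exact: (fmap s (ab : @Hom (posetC (ordP k)) _ _)).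
Qed.

Definition image_chain k n (H : {set faceT n}) (s : SdDelta n k)
    (sH : forall b, s b \in H) : Mono (faceP k) (chainP H).
Proof.
refine (@MkMono (faceP k) (chainP H)
  (fun T => exist _ ((s : 'I_k.+1 -> faceT n) @: val T) (mono_chain T sH)) _).
by move=> S T; exact: imsetS.
Defined.

(** The dimension of a face. *)
Definition rank n (S : faceP n) : 'I_n.+1 := inord #|val S|.-1.

Lemma rankS n (S : faceP n) : (rank S).+1 = #|val S| :> nat.
Proof.
case: S => S S0; rewrite /rank /=; have := S0; rewrite -card_gt0.
case E: #|S| => [//|j] _ /=; rewrite inordK //.
by rewrite -E -[X in _ <= X]card_ord max_card.
Qed.

Lemma chain_rank_le n (H : {set faceT n}) (c : chainP H) (S T : faceP n) :
  S \in val c -> T \in val c -> rank S <= rank T -> ple S T.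
Proof.
move=> Sc Tc; rewrite -ltnS !rankS => ST; case: (chain_cmp Sc Tc) => // TS.
suff -> : S = T by exact: ple_refl.
by apply/esym/val_inj/eqP; rewrite eqEcard TS.
Qed.

Lemma chain_rank_inj n (H : {set faceT n}) (c : chainP H) (S T : faceP n) :
  S \in val c -> T \in val c -> rank S = rank T -> S = T.
Proof.
by move=> Sc Tc e; apply: ple_anti; apply: (chain_rank_le (c := c)) => //; rewrite e.
Qed.

Lemma ranks_neq0 n (H : {set faceT n}) (c : chainP H) :
  (@rank n : faceT n -> _) @: val c != set0.
Proof.
have /set0Pn[S Sc] := chain_neq0 c.
by apply/set0Pn; exists (rank S); exact: imset_f.
Qed.

Definition rank_map n (H : {set faceT n}) : Mono (chainP H) (faceP n).
Proof.
refine (@MkMono (chainP H) (faceP n) 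
  (fun c => exist (fun S => S != set0) _ (ranks_neq0 c)) _).
by move=> c d; exact: imsetS.
Defined.

(** A simplex of the subdivision whose vertices are the members of [c].  It is
    repeated degenerately so that its dimension does not depend on [c] and each
    member sits at the position of its rank. *)
Lemma spanning_simplex n (H : {set faceT n}) (c : chainP H) :
  exists s : SdDelta n n, (forall j, s j \in val c) /\
    forall S, S \in val c -> s (rank S) = S.
Proof.
have [r [rc r_id]] := face_retraction (rank_map H c).
have ex (j : 'I_n.+1) : exists S : faceT n, S \in val c /\ rank S = r j.
  by have /imsetP[S Sc ->] := rc j; exists S.
have [s sP] := fin_all_exists ex.
have s_le (i j : 'I_n.+1) : i <= j -> @ple (faceP n) (s i) (s j).
  move=> ij; apply: (chain_rank_le (sP i).1 (sP j).1).
  by rewrite (sP i).2 (sP j).2; exact: (mfun_le r (ij : @ple (ordP n) i j)).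
exists (simplex s_le); split=> [j|S Sc] /=; first exact: (sP j).1.
apply: (chain_rank_inj (sP _).1 Sc); rewrite (sP _).2.
by apply: r_id; exact: imset_f.
Qed.

Definition horn_faces n (i : 'I_n.+1) : {set faceT n} :=
  [set S : faceT n | [exists j, (j != i) && (j \notin val S)]].

Lemma horn_facesP n (i : 'I_n.+1) (S : faceP n) :
  reflect (exists j, j <> i /\ j \notin val S) (S \in horn_faces i).
Proof.
rewrite inE; apply: (iffP existsP) => [[j /andP[/eqP ji jS]]|[j [/eqP ji jS]]].
  by exists j.
by exists j; rewrite ji.
Qed.

(** * Chains of horn faces *)

Section HornChains.
Variables (n : nat) (i : 'I_n.+1).
Let H := horn_faces i.

Lemma horn_simplex_faces m (x : Horn i m) k (s : SdDelta m k) b :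
  SdDelta_map (proj1_sig x) k s b \in H.
Proof.
case: x => x /= [j [ji xj]]; apply/horn_facesP; exists j; split=> //.
by apply/imsetP => -[a _ /esym]; exact: xj.
Qed.

(** The chains of horn faces represented by a simplex of Sd^2 of the horn. *)
Definition horn_chain m (x : Horn i m) k (s : SdDelta m k) l (u : SdDelta k l) :
    nerve (posetC (chainP H)) l :=
  compF (posetF (image_chain (horn_simplex_faces x s))) u.

Lemma retraction_in_horn (S : faceP n) (r : Mono (ordP n) (ordP n)) :
  S \in H -> (forall a, r a \in val S) -> @in_horn n i n r.
Proof.
case/horn_facesP=> j [ji jS] rS; exists j; split=> // a raj.
by move: jS; rewrite -raj rS.
Qed.

(** Every increasing sequence of chains of horn faces is represented by a
    simplex of Sd^2 of the horn, and all of its representatives have the same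
    image under any map.  The chosen representative takes a retraction [r] onto
    the largest face of the last chain, a spanning simplex [s] of that chain,
    and the sets of ranks; any other one is brought to it by naturality. *)
Lemma horn_lift l (v : nerve (posetC (chainP H)) l) :
  exists (x : Horn i n) (s : SdDelta n n) (u : SdDelta n l),
    horn_chain x s u = v /\
    forall (Y : SSet) (f : SMap (Horn i) (Ex (Ex Y)))
      m (x' : Horn i m) k (s' : SdDelta m k) (u' : SdDelta k l),
      horn_chain x' s' u' = v -> f m x' k s' l u' = f n x n s l u.
Proof.
pose c : chainP H := v (ord_max : ordP l).
have vc p S : S \in val (v p) -> S \in val c.
  by have /subsetP := fmap v (leq_ord p : @Hom (posetC (ordP l)) p ord_max); exact.
have [s [s_c s_rank]] := spanning_simplex c.
pose S1 := s (ord_max : ordP n).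
have S1c : S1 \in val c by exact: s_c.
have S1_max S : S \in val c -> val S \subset val S1.
  move=> Sc; rewrite -(s_rank S Sc).
  exact: (fmap s (leq_ord (rank S) : @Hom (posetC (ordP n)) _ ord_max)).
have [r [rS1 r_id]] := face_retraction S1.
have r_fix S : S \in val c -> face_map r S = S.
  by move=> Sc; apply: face_map_id => a /(subsetP (S1_max S Sc)); exact: r_id.
pose x : Horn i n := exist _ r (retraction_in_horn (chain_in S1c) rS1).
pose u : SdDelta n l := compF (posetF (rank_map H)) v.
exists x, s, u; split.
  apply: posetF_eq => p; apply/val_inj/setP => S /=; apply/imsetP/idP.
    case=> _ /imsetP[T Tv ->] ->.
    have Tc := vc _ _ Tv; rewrite s_rank //.
    by rewrite -[X in X \in _]/(face_map r T) r_fix.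
  move=> Sv; exists (rank S); first exact: imset_f.
  have Sc := vc _ _ Sv; rewrite s_rank //.
  by rewrite -[RHS]/(face_map r S) r_fix.
move=> Y f m x' k s' u' ev.
(* Both simplices of the horn are restrictions of a retraction x'' onto the
   image S' of x', which contains S1; by naturality x' and x reduce to x''. *)
have full0 : [set: 'I_m.+1] != set0 by apply/set0Pn; exists ord0.
pose S' : faceP n := face_map (proj1_sig x') (exist (fun S => S != set0) _ full0).
have x'S' a : proj1_sig x' a \in val S' by apply: imset_f; rewrite inE.
have S'H : S' \in H.
  have [j [ji xj]] := proj2_sig x'; apply/horn_facesP; exists j; split=> //.
  by apply/imsetP => -[a _ /esym]; exact: xj.
have [r' [r'S' r'_id]] := face_retraction S'.
pose x'' : Horn i n := exist _ r' (retraction_in_horn S'H r'S').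
pose t := SdDelta_map (proj1_sig x') k s'.
have vt p : val (v p) = (t : 'I_k.+1 -> faceT n) @: val (u' p) by rewrite -ev.
have ex' : x' = act (proj1_sig x') x''.
  apply: eq_sig_hprop => /= [*|]; first exact: proof_irrelevance.
  by apply: Mono_eq => a /=; rewrite r'_id.
have ex : x = act r x''.
  apply: eq_sig_hprop => /= [*|]; first exact: proof_irrelevance.
  apply: Mono_eq => a /=; rewrite r'_id //.
  have: S1 \in val (v ord_max) by [].
  rewrite vt => /imsetP[b _ eS1]; have := rS1 a; rewrite eS1 => /imsetP[d _ ->].
  exact: x'S'.
have -> : f m x' k s' l u' = f n x'' k t l u' by rewrite {1}ex' sfun_nat.
have es : SdDelta_map r n s = s by apply: posetF_eq => j; exact: r_fix (s_c j).
have -> : f n x n s l u = f n x'' n s l u.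
  by rewrite ex sfun_nat -[LHS]/(f n x'' n (SdDelta_map r n s) l u) es.
move: (f n x'') => /= {ex ex'} g.
(* Retracting [k] onto the last term of u' makes the members of c the only
   vertices of t; then t is a degeneracy of the spanning simplex s. *)
have [rho [rho_last rho_id]] := face_retraction (u' (ord_max : ordP l)).
have rho_u p b : b \in val (u' p) -> rho b = b.
  move=> bu; apply: rho_id; move: bu; apply/subsetP.
  exact: (fmap u' (leq_ord p : @Hom (posetC (ordP l)) p ord_max)).
have erho : SdDelta_map rho l u' = u'.
  by apply: posetF_eq => p; apply: face_map_id; exact: rho_u.
have rho_c b : t (rho b) \in val c.
  by have := vt ord_max; rewrite -/c => ->; apply: imset_f; exact: rho_last.
have phi_le (a b : ordP k) : ple a b ->
    @ple (ordP n) (rank (t (rho a))) (rank (t (rho b))).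
  move=> ab; rewrite /= -ltnS !rankS; apply: subset_leq_card.
  exact: (fmap t (mfun_le rho ab)).
pose phi := MkMono phi_le.
have ephi : act rho t = act phi s.
  apply: posetF_eq => b; symmetry; exact: s_rank (rho_c b).
have eu : SdDelta_map phi l u' = u.
  apply: posetF_eq => p; apply: val_inj => /=.
  rewrite vt -imset_comp; apply: eq_in_imset => b bu /=.
  by rewrite (rho_u p).
rewrite -{1}erho -[LHS]/(act rho (g k t) l u') -sfun_nat ephi sfun_nat.
by rewrite -[LHS]/(g n s l (SdDelta_map phi l u')) eu.
Qed.

(** In adjoint form: a map out of Sd^2 of the horn factors through the nerve of
    the poset of chains of horn faces. *)
Lemma horn_descent (Y : SSet) (f : SMap (Horn i) (Ex (Ex Y))) :
  exists phi : SMap (nerve (posetC (chainP H))) Y,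
    forall m (x : Horn i m) k (s : SdDelta m k) l (u : SdDelta k l),
      f m x k s l u = phi l (horn_chain x s u).
Proof.
have lift l (v : nerve (posetC (chainP H)) l) : {y : Y l |
    (exists (x : Horn i n) (s : SdDelta n n) (u : SdDelta n l),
      horn_chain x s u = v) /\
    forall m (x : Horn i m) k (s : SdDelta m k) (u : SdDelta k l),
      horn_chain x s u = v -> f m x k s l u = y}.
  apply: cid; have [x [s [u [e fE]]]] := horn_lift v.
  by exists (f n x n s l u); split; [exists x, s, u | exact: fE].
unshelve eexists.
  refine (@MkSMap (nerve (posetC (chainP H))) Y
    (fun l v => proj1_sig (lift l v)) _).
  move=> l' l th v; case: (lift l v) => y [[x [s [u e]]] fE] /=.
  case: (lift l' _) => y' [_ fE'] /=.
  rewrite -(fE _ _ _ _ _ e) -(fE' _ x _ s (act th u)) ?sfun_nat //.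
  by rewrite -e; exact: posetF_eq.
by move=> m x k s l u /=; case: lift => y [_] /= ->.
Qed.

End HornChains.

(** * Contracting the poset of chains *)

Lemma seq_In (T : eqType) (x : T) (e : seq T) : x \in e -> List.In x e.
Proof.
elim: e => //= y e IHe; rewrite inE => /orP[/eqP->|/IHe]; by [left | right].
Qed.

Lemma pairwise_ForallOrdPairs (T : Type) (r : rel T) (R : T -> T -> Prop)
    (e : seq T) :
  (forall x y, r x y -> R x y) -> pairwise r e -> List.ForallOrdPairs R e.
Proof.
move=> rR; elim: e => [_|x e IHe /= /andP[xe re]]; first by constructor.
constructor; last exact: IHe.
by elim: e xe {IHe re} => [|y e IHe] /=; [constructor|
  move=> /andP[/rR xy xe]; constructor; [|exact: IHe]].
Qed.

(** Sorting by decreasing number of members gives a decreasing linear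
    extension. *)
Lemma chain_enum n (H : {set faceT n}) : exists e : seq (chainP H),
  List.ForallOrdPairs (fun c d => ple c d -> c = d) e /\
  forall c, List.In c e.
Proof.
pose T := {c : {set faceT n} | chain_on H c}.
pose r (c d : T) := #|val d| <= #|val c|.
have r_total : total r by move=> c d; exact: leq_total.
have r_trans : transitive r by move=> c d e cd /leq_trans; exact.
exists (sort r (enum {: T})); split.
  apply: (@pairwise_ForallOrdPairs T r) => [c d dc cd|].
    by apply/val_inj/eqP; rewrite eqEcard; apply/andP.
  by rewrite -sorted_pairwise // sort_sorted.
by move=> c; apply: (@seq_In T); rewrite mem_sort mem_enum.
Qed.

Section NullChains.
Variables (C : Category) (cof fib : MorClass C).
Hypothesis CF : factorization_classes cof fib.
Variables (n : nat) (i : 'I_n.+1).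
Let H := horn_faces i.
Let K := chainP H.
Variable X : Functor (posetC K) C.

Let along (a : Mono K K) := compF X (posetF a).

Lemma along_natural (a b : Mono K K)
    (ab : forall c, @Hom (posetC K) (a c) (b c)) :
  @natural _ _ (along a) (along b) (fun c => fmap X (ab c)).
Proof.
by move=> c d cd /=; rewrite -!fmap_cmp; f_equal; exact: posetC_thin.
Qed.

Lemma null_down (a b : Mono K K) : (forall c, ple (a c) (b c)) ->
  Null (along b) -> Null (along a).
Proof.
by move=> ab; apply: null_pre; exact: (along_natural (a := a) (b := b) ab).
Qed.

Lemma null_up (a b : Mono K K) : (forall c, ple (a c) (b c)) ->
  Null (along a) -> Null (along b).
Proof.
move=> ab; have [e [ord_e all_e]] := cid (chain_enum H).
exact: (null_post CF ord_e all_e (along_natural (a := a) (b := b) ab)).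
Qed.

Definition preserves (h : Mono (faceP n) (faceP n)) :=
  forall S : faceP n, S \in H -> h S \in H.

Lemma sd_map_chain h (hH : preserves h) (c : K) :
  chain_on H ((h : faceT n -> faceT n) @: val c).
Proof.
have /set0Pn[S Sc] := chain_neq0 c.
apply/and3P; split; first by apply/set0Pn; exists (h S); exact: imset_f.
  by apply/subsetP => _ /imsetP[T /chain_in TH ->]; exact: hH.
apply/is_chainP => _ _ /imsetP[T Tc ->] /imsetP[U Uc ->].
by case: (chain_cmp Tc Uc) => le; [left|right]; exact: mfun_le.
Qed.

Definition sd_map h (hH : preserves h) : Mono K K.
Proof.
refine (@MkMono K K
  (fun c => exist (chain_on H) _ (sd_map_chain hH c)) _).
by move=> c d; exact: imsetS.
Defined.

Section Sweep.
Variables (f g : Mono (faceP n) (faceP n)).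
Hypotheses (fg : forall S, ple (f S) (g S)).
Hypotheses (fH : preserves f) (gH : preserves g).

(** The stages of the passage from [f] to [g]: the faces with more than [t]
    vertices have already moved. *)
Definition sweep (t : nat) (S : faceT n) : faceT n :=
  if t < #|val S| then g S else f S.

(** Consecutive stages are comparable in both directions on faces of different
    cardinality: if [S] has moved at stage [t], a strictly larger [T] has moved
    at stage [t.+1]. *)
Lemma sweep_le t u (S T : faceP n) :
  ple S T -> (u <= t) || (u <= t.+1) && (S != T :> faceT n) ->
  @ple (faceP n) (sweep t S) (sweep u T).
Proof.
move=> ST tu; rewrite /sweep; case: ifP => tS; case: ifP => uT.
- exact: mfun_le.
- case/negP: uT; case/orP: tu => [ut|/andP[ut nST]].
    exact: leq_ltn_trans ut (leq_trans tS (subset_leq_card ST)).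
  apply: leq_ltn_trans ut (leq_ltn_trans tS _); apply: proper_card.
  by rewrite properEneq -[X in X && _]/(S != T :> faceT n) nST.
- exact: ple_trans (mfun_le f ST) (fg T).
- exact: mfun_le.
Qed.

Definition sweep_sets (t u : nat) (c : {set faceT n}) :=
  sweep t @: c :|: sweep u @: c.

(** Both stages of a single face are comparable because f <= g, and those of
    distinct members of [c] by [sweep_le]. *)
Lemma sweep_chain t u (c : K) : u <= t <= u.+1 ->
  chain_on H (sweep_sets t u (val c)).
Proof.
move=> /andP[ut tu].
have sweepH w S : S \in val c -> sweep w S \in H.
  by move=> /chain_in SH; rewrite /sweep; case: ifP => _; [exact: gH|exact: fH].
apply/and3P; split.
- have /set0Pn[S Sc] := chain_neq0 c; apply/set0Pn; exists (sweep t S).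
  by rewrite inE imset_f.
- by apply/subsetP => S /setUP[] /imsetP[T Tc ->]; exact: sweepH.
have near w w' : w \in [:: t; u] -> w' \in [:: t; u] -> w <= w'.+1.
  rewrite !inE => /orP[]/eqP-> /orP[]/eqP->; rewrite ?leqnSn //.
  exact: leq_trans ut (leqnSn t).
have key w w' (S T : faceP n) : w \in [:: t; u] -> w' \in [:: t; u] -> ple S T ->
    @ple (faceP n) (sweep w S) (sweep w' T) \/
    @ple (faceP n) (sweep w' T) (sweep w S).
  move=> wtu wtu' ST; have [eST|nST] := eqVneq (S : faceT n) T.
    rewrite eST; case/orP: (leq_total w w') => ww; [right|left];
      by apply: sweep_le; rewrite ?ww //; exact: ple_refl.
  by left; apply: sweep_le => //; rewrite (near w' w) // nST orbT.
have mem_sweep S : S \in sweep_sets t u (val c) ->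
    exists2 w, w \in [:: t; u] & exists2 T, T \in val c & S = sweep w T.
  by case/setUP => /imsetP[T Tc ->]; [exists t|exists u];
    rewrite ?inE ?eqxx ?orbT //; exists T.
apply/is_chainP => _ _ /mem_sweep[w wtu [S Sc ->]] /mem_sweep[w' wtu' [T Tc ->]].
case: (chain_cmp Sc Tc) => le; first exact: key.
by case: (key w' w T S wtu' wtu le); [right|left].
Qed.

Definition sweep_map t u (tu : u <= t <= u.+1) : Mono K K.
Proof.
refine (@MkMono K K
  (fun c => exist (chain_on H) _ (sweep_chain c tu)) _).
by move=> c d cd; apply: setUSS; exact: imsetS.
Defined.

Lemma diag_le t : t <= t <= t.+1. Proof. by rewrite leqnn leqnSn. Qed.
Lemma next_le t : t <= t.+1 <= t.+1. Proof. by rewrite leqnn leqnSn. Qed.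

(** The maps of chains induced by the stages [t] and [t.+1] both lie below the
    map that sends a chain to the union of its two images. *)
Lemma null_sweepS t :
  (Null (along (sweep_map (diag_le t))) ->
   Null (along (sweep_map (diag_le t.+1)))) *
  (Null (along (sweep_map (diag_le t.+1))) ->
   Null (along (sweep_map (diag_le t)))).
Proof.
have le0 c : ple (sweep_map (diag_le t) c) (sweep_map (next_le t) c).
  by rewrite /= /sweep_sets setUid subsetUr.
have le1 c : ple (sweep_map (diag_le t.+1) c) (sweep_map (next_le t) c).
  by rewrite /= /sweep_sets setUid subsetUl.
by split=> N; [apply: null_down le1 _ | apply: null_down le0 _];
  [apply: null_up le0 N | apply: null_up le1 N].
Qed.

(** At stage 0 all the faces have moved, and at stage n + 1 none. *)
Lemma null_homotopic :
  (Null (along (sd_map fH)) -> Null (along (sd_map gH))) *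
  (Null (along (sd_map gH)) -> Null (along (sd_map fH))).
Proof.
have sweep0 c : val (sweep_map (diag_le 0) c) = val (sd_map gH c).
  rewrite /= /sweep_sets setUid; apply: eq_imset => S.
  by rewrite /sweep card_gt0 (valP S).
have sweepn c : val (sweep_map (diag_le n.+1) c) = val (sd_map fH c).
  rewrite /= /sweep_sets setUid; apply: eq_imset => S.
  by rewrite /sweep ltnNge -[X in _ <= X]card_ord max_card.
pose swp t := sweep_map (diag_le t).
have [up down] : (Null (along (swp n.+1)) -> Null (along (swp 0))) *
                 (Null (along (swp 0)) -> Null (along (swp n.+1))).
  elim: (n.+1) => // t [IHd IHu].
  split=> [/(null_sweepS t).2|N]; first exact: IHd.
  by apply: (null_sweepS t).1; exact: IHu.
have le_val (p q : Mono K K) : (forall c, val (p c) = val (q c)) ->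
    Null (along p) -> Null (along q).
  by move=> pq; apply: null_down => c; rewrite /= pq.
split=> N.
  by apply: le_val sweep0 (up (le_val _ _ _ N)) => c; rewrite sweepn.
by apply: le_val sweepn (down (le_val _ _ _ N)) => c; rewrite sweep0.
Qed.

End Sweep.

Lemma mem_neq0 (A : {set 'I_n.+1}) : i \in A -> A != set0.
Proof. by move=> iA; apply/set0Pn; exists i. Qed.

Definition with_vertex (A : {set 'I_n.+1}) (iA : i \in A) : faceP n :=
  exist (fun S : {set 'I_n.+1} => S != set0) A (mem_neq0 iA).

Definition add_vertex : Mono (faceP n) (faceP n).
Proof.
refine (@MkMono (faceP n) (faceP n) (fun S => with_vertex (setU11 i (val S))) _).
by move=> S T ST; exact: setUS.
Defined.

Definition to_vertex : Mono (faceP n) (faceP n) :=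
  @MkMono (faceP n) (faceP n) (fun=> with_vertex (set11 i))
    (fun _ _ _ => ple_refl _).

(** Adding the vertex i to a face of the i-th horn gives a face of the horn,
    which contains both the original face and the vertex i. *)
Lemma null_horn : 0 < n -> Null X.
Proof.
move=> n_gt0.
have addH : preserves add_vertex.
  move=> S /horn_facesP[j [ji jS]]; apply/horn_facesP; exists j; split=> //=.
  by rewrite !inE negb_or jS andbT; apply/eqP.
(* The vertex i is a face of the horn because n > 0 provides another vertex. *)
have vertexH S : to_vertex S \in H.
  apply/horn_facesP; have: 0 < #|[set~ i]| by rewrite cardsC1 card_ord.
  case/card_gt0P => j; rewrite !inE => /eqP ji.
  by exists j; split=> //=; rewrite inE; apply/eqP.
have idH : preserves (mono_id _) by [].
have toH : preserves to_vertex by move=> S _; exact: vertexH.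
have add_ge S : ple (mono_id (faceP n) S) (add_vertex S) by exact: subsetUr.
have add_to S : ple (to_vertex S) (add_vertex S) by exact: subsetUl.
have N : Null (along (sd_map toH)).
  pose v : faceT n := with_vertex (set11 i).
  have vc : chain_on H [set v].
    rewrite /chain_on sub1set -[v \in H]/(to_vertex v \in H) vertexH andTb.
    apply/andP; split.
      by apply/set0Pn; exists v; rewrite inE.
    by apply/is_chainP => S T /set1P-> /set1P->; left; exact: ple_refl.
  pose c0 : K := exist (chain_on H) _ vc.
  pose k0 : Mono K K := @MkMono K K (fun=> c0) (fun _ _ _ => ple_refl c0).
  apply: (@null_down _ k0).
    by move=> c; apply/subsetP => _ /imsetP[S _ ->]; rewrite inE.
  apply: (@null_pre _ _ (along k0) (constF (posetC K) (X c0)) (fun=> idm (X c0))).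
    by move=> c d cd /=; rewrite !cmp_idl -(fmap_id X c0).
  exact: null_const.
have {}N : Null (along (sd_map idH)).
  apply: (null_homotopic add_ge idH addH).2.
  exact: (null_homotopic add_to toH addH).1.
have le_id (c : K) : @Hom (posetC K) c (sd_map idH c).
  by rewrite /= imset_id.
apply: null_pre N; last first.
  exact: (along_natural (a := mono_id K) (b := sd_map idH) le_id).
Qed.

End NullChains.

(** * Extension along the inclusion of the horn *)

(** The cospan X -> Y <- L as one functor, on two copies of [K] and a further
    element below the second copy. *)
Section Cylinder.
Variable K : Poset.

Inductive cyl := Base (q : K) | Top (q : K) | Apex.

Definition cyl_le (a b : cyl) : Prop :=
  match a, b with
  | Base p, Base q | Base p, Top q | Top p, Top q => ple p q
  | Apex, Top _ | Apex, Apex => True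
  | _, _ => False
  end.

Definition cylP : Poset.
Proof.
refine (@MkPoset cyl cyl_le _ _ _).
- by case=> //= q; exact: ple_refl.
- by case=> [p|p|] [q|q|] [r|r|] //=; exact: ple_trans.
- by case=> [p|p|] [q|q|] //= pq qp; rewrite (ple_anti pq qp).
Defined.

Variables (C : Category) (X : Functor (posetC K) C) (N : Null X).

Definition cyl_ob (a : cyl) : C :=
  match a with
  | Base q => X q
  | Top q => null_dgm N q
  | Apex => null_apex N
  end.

Definition cyl_hom (a b : cyl) : cyl_le a b -> Hom (cyl_ob a) (cyl_ob b) :=
  match a, b with
  | Base p, Base q => fun pq => fmap X (pq : @Hom (posetC K) p q)
  | Base p, Top q => fun pq =>
      fmap (null_dgm N) (pq : @Hom (posetC K) p q) \c null_map N p
  | Top p, Top q => fun pq => fmap (null_dgm N) (pq : @Hom (posetC K) p q)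
  | Apex, Top q => fun _ => null_cone N q
  | Apex, Apex => fun _ => idm _
  | _, _ => fun no => False_rect _ no
  end.

Definition cylF : Functor (posetC cylP) C.
Proof.
refine (@MkFunctor (posetC cylP) C cyl_ob cyl_hom _ _).
- by case=> [q|q|] //=; rewrite -fmap_id; f_equal; exact: posetC_thin.
- case=> [p|p|] [q|q|] [r|r|] //= qr pq.
  + by rewrite -fmap_cmp; f_equal; exact: posetC_thin.
  + rewrite -cmp_assoc null_map_nat cmp_assoc -fmap_cmp.
    by do 2 f_equal; exact: posetC_thin.
  + by rewrite cmp_assoc -fmap_cmp; do 2 f_equal; exact: posetC_thin.
  + by rewrite -fmap_cmp; f_equal; exact: posetC_thin.
  + by rewrite null_cone_nat.
  + by rewrite cmp_idr.
  + by rewrite cmp_idl.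
Defined.

Definition baseM : Mono K cylP := @MkMono K cylP Base (fun _ _ h => h).

Lemma cylF_base : compF cylF (posetF baseM) = X.
Proof. by apply: functor_eq_arrows. Qed.

End Cylinder.

Section Extension.
Variables (n : nat) (H : {set faceT n}).
Let K := chainP H.
Let P := chainP [set: faceT n].

Lemma chain_subset (c : K) :
  chain_on [set: faceT n] (val c).
Proof. by case/and3P: (valP c) => c0 _ ch; apply/and3P; rewrite subsetT. Qed.

Definition inclM : Mono K P :=
  @MkMono K P (fun c => 
    exist (chain_on setT) _ (chain_subset c)) (fun _ _ h => h).

Definition trace (c : P) : option K := insub (val c :&: H).

Variant trace_spec (c : P) : option K -> Prop :=
| TraceSome (q : K) of val q = val c :&: H : trace_spec c (Some q)
| TraceNone of val c :&: H = set0 : trace_spec c None.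

Lemma traceP c : trace_spec c (trace c).
Proof.
rewrite /trace; case: insubP => [q _|]; first exact: TraceSome.
rewrite /chain_on subsetIr /= negb_and negbK => /orP[/eqP|/negP[]]; first exact: TraceNone.
apply/is_chainP => S T /setIP[Sc _] /setIP[Tc _]; exact: (chain_cmp Sc Tc).
Qed.

(** The chains in the horn go to the first copy of [K], and the others to their
    trace in the second copy, or to the apex if they miss the horn. *)
Definition to_cyl_fun (c : P) : cyl K :=
  if trace c is Some q then if val c \subset H then Base q else Top q
  else @Apex K.

Lemma to_cyl_le (c d : P) : ple c d -> cyl_le (to_cyl_fun c) (to_cyl_fun d).
Proof.
move=> cd; rewrite /to_cyl_fun.
case: (traceP c) => [p ep|c0]; case: (traceP d) => [q eq|d0].
- have pq : ple p q by rewrite /= ep eq; exact: setSI.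
  by case: ifP => cH; case: ifP => dH //=; case/negP: cH; exact: subset_trans dH.
- have /set0Pn[S] := chain_neq0 p; rewrite ep => /setIP[Sc SH].
  have : S \in val d :&: H by rewrite inE SH (subsetP cd).
  by rewrite d0 inE.
- case: ifP => //= dH; have /set0Pn[S Sc] := chain_neq0 c.
  have : S \in val c :&: H by rewrite inE Sc (subsetP dH) // (subsetP cd).
  by rewrite c0 inE.
- by [].
Qed.

Definition to_cyl : Mono P (cylP K) := @MkMono P (cylP K) to_cyl_fun to_cyl_le.

Lemma to_cyl_incl (c : K) : to_cyl (inclM c) = baseM K c.
Proof.
have cH : val c \subset H by case/and3P: (valP c).
have cHc : val c :&: H = val c by apply/setIidPl.
rewrite /= /to_cyl_fun; case: traceP => [q eq_q|/= c0].
  by rewrite cH; congr Base; apply: val_inj; exact: etrans eq_q cHc.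
by have := chain_neq0 c; rewrite -cHc c0 eqxx.
Qed.

Lemma extension (C : Category) (X : Functor (posetC K) C) : Null X ->
  exists G : Functor (posetC P) C, compF G (posetF inclM) = X.
Proof.
move=> N; exists (compF (cylF N) (posetF to_cyl)).
have e : compF (posetF to_cyl) (posetF inclM) = posetF (baseM K).
  by apply: posetF_eq => c; exact: to_cyl_incl.
transitivity (compF (cylF N) (compF (posetF to_cyl) (posetF inclM))).
  exact: functor_eq_arrows.
by rewrite e cylF_base.
Qed.

End Extension.

(** * Fibrancy *)

Lemma compF_assoc (A B C D : Category) (H : Functor C D) (G : Functor B C)
    (F : Functor A B) : compF (compF H G) F = compF H (compF G F).
Proof. exact: functor_eq_arrows. Qed.

(** By the Yoneda lemma a filler is a single n-simplex of Ex^2, which the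
    extended functor provides. *)
Lemma factorization_fibrant (C : Category) (cof fib : MorClass C) :
  factorization_classes cof fib -> Thomason_fibrant C.
Proof.
move=> CF n i f n_gt0.
have [phi fE] := horn_descent f.
have [X phiE] := nerve_full phi.
have [G GX] := extension (null_horn CF X n_gt0).
have allT k (s : SdDelta n k) b : s b \in [set: faceT n] by rewrite inE.
pose z (k : nat) (s : SdDelta n k) : SMap (SdDelta k) (nerve C) :=
  nerve_map (compF G (posetF (image_chain (allT k s)))).
have z_nat k' k (th : Mono (ordP k') (ordP k)) (s : SdDelta n k) :
    z k' (act th s) = act th (z k s : Ex (nerve C) k).
  apply: SMap_eq => l u; rewrite /= !compF_assoc; congr compF.
  by apply: posetF_eq => p; apply: val_inj; rewrite /= -imset_comp.
pose Z : Ex (Ex (nerve C)) n := @MkSMap (SdDelta n) (Ex (nerve C)) z z_nat.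
unshelve eexists (@MkSMap (Delta n) (Ex (Ex (nerve C))) (fun m x => act x Z) _).
  by move=> m' m h x; exact: act_cmp.
move=> m x; apply: SMap_eq => k s; apply: SMap_eq => l u.
rewrite fE phiE -GX /= !compF_assoc; congr compF.
by apply: posetF_eq => p; exact: val_inj.
Qed.

Theorem mainTheorem1 (M : RelativeCategory) (hM : partial_model_category M) :
  Thomason_fibrant (weqC M).
Proof.
have [cof [fib CF]] := weqC_factorization_classes hM.
exact: factorization_fibrant CF.
Qed.
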